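(* Let $k\ge 2$ and let $G\cong K_{r_1,r_2,\ldots,r_k}$ be a complete $k$-partite graph such that $r_1=r_2=\cdots=r_k\ge 2$ and $\sum_{i=1}^k r_i=n$. Then $\dim_{ms}(G)=n-1$.
   Context: For a simple connected graph $G$, $d_G(u,v)$ is the length of a shortest $u$–$v$ path. For $S=\{w_1,\ldots,w_t\}\subseteq V(G)$ and $u\in V(G)$, the multiset representation of $u$ with respect to $S$ is the multiset $\operatorname{m}(u|S)$ consisting of $d_G(u,w_1),\ldots,d_G(u,w_t)$, counted with multiplicity. A set $S$ is an outer multiset resolving set if $\operatorname{m}(u|S)\ne \operatorname{m}(v|S)$ for every two distinct $u,v\in V(G)\setminus S$; the outer multiset dimension $\dim_{ms}(G)$ is the minimum cardinality of such a set. $K_{r_1,\ldots,r_k}$ is the complete $k$-partite graph with parts of sizes $r_1,\ldots,r_k$. *)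

(* Defs.v *)
From HB Require Import structures.
From mathcomp Require Import all_boot all_order.
From mathcomp Require Import finmap multiset.

Set Implicit Arguments.
Unset Strict Implicit.
Unset Printing Implicit Defensive.

Local Open Scope mset_scope.

Record sgraph := SGraph {
  vertex :> finType;
  adj : rel vertex;
  adj_sym : symmetric adj;
  adj_irrefl : irreflexive adj }.

Record cgraph := CGraph {
  cgraph_sgraph :> sgraph;
  cgraph_connected :
    forall u v : cgraph_sgraph, connect (@adj cgraph_sgraph) u v }.

Definition graph_iso (G H : sgraph) : Prop :=
  exists f : G -> H, bijective f /\ forall u v : G, adj (f u) (f v) = adj u v.

(* MathComp's [path] allows repeated vertices, hence [uniq]; the path
   u :: p has size p edges. *)
Definition has_path_of_length (G : sgraph) (u v : G) (l : nat) : bool :=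
  [exists p : l.-tuple G,
     [&& path (@adj G) u p, uniq (u :: p) & last u p == v]].

Lemma has_path_of_some_length (G : cgraph) (u v : G) :
  exists l, has_path_of_length u v l.
Proof.
have /connectP [p ep ->] := cgraph_connected u v.
case: (shortenP ep) => p' ep' up' _; exists (size p').
by apply/existsP; exists (in_tuple p'); rewrite ep' up' eqxx.
Qed.

Definition dist (G : cgraph) (u v : G) : nat :=
  ex_minn (has_path_of_some_length u v).

Definition mset_repr (G : cgraph) (u : G) (S : {set G}) : {mset nat} :=
  seq_mset [seq dist u w | w <- enum S].

Definition outer_mset_resolving (G : cgraph) (S : {set G}) : bool :=
  [forall u, forall v,
     [&& u \notin S, v \notin S & u != v] ==> (mset_repr u S != mset_repr v S)].

Lemma outer_mset_resolvingT (G : cgraph) : @outer_mset_resolving G [set: G].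
Proof. by apply/'forall_forallP => u v; rewrite inE. Qed.

Lemma outer_mset_resolving_card_ex (G : cgraph) :
  exists m, [exists S : {set G}, outer_mset_resolving S && (#|S| == m)].
Proof.
exists #|[set: G]|; apply/existsP; exists [set: G].
by rewrite outer_mset_resolvingT eqxx.
Qed.

Definition dim_ms (G : cgraph) : nat :=
  ex_minn (outer_mset_resolving_card_ex G).

Section CompleteMultipartite.
Variables (k : nat) (r : 'I_k -> nat).

(* The vertex Tagged _ x, with x : 'I_(r i), is the x-th vertex of part i. *)
Let V : finType := {i : 'I_k & 'I_(r i)}.

Definition multipartite_adj : rel V := fun u v => tag u != tag v.

Lemma multipartite_adj_sym : symmetric multipartite_adj.
Proof. by move=> u v; rewrite /multipartite_adj eq_sym. Qed.

Lemma multipartite_adj_irrefl : irreflexive multipartite_adj.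
Proof. by move=> u; rewrite /multipartite_adj eqxx. Qed.

Definition complete_multipartite : sgraph :=
  SGraph multipartite_adj_sym multipartite_adj_irrefl.

Lemma complete_multipartite_connected :
  2 <= k -> (forall i, 0 < r i) ->
  forall u v : complete_multipartite,
    connect (@adj complete_multipartite) u v.
Proof.
move=> k2 r0 u v.
have [tuv|] := eqVneq (tag u) (tag v); last by move=> ?; apply: connect1.
have [j juv] : exists j : 'I_k, j != tag u.
  apply/existsP; apply: contraLR k2 => /existsPn H.
  rewrite -leqNgt -(card_ord k) -(card1 (tag u)).
  by apply: subset_leq_card; apply/subsetP => j _; have := H j; rewrite negbK.
pose w : complete_multipartite :=
  Tagged (fun i => 'I_(r i)) (Ordinal (r0 j) : 'I_(r j)).
apply: (@connect_trans _ _ w); apply: connect1; rewrite /= /multipartite_adj /=.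
  by rewrite eq_sym.
by rewrite -tuv.
Qed.

End CompleteMultipartite.

(* Main.v *)
Require Import Defs.
From mathcomp Require Import all_boot all_order.
From mathcomp Require Import finmap multiset.

(** In a complete multipartite graph distinct vertices are at distance 2 or 1
    according to whether they lie in the same part. Hence, for [u] outside [S],
    the multiset [m(u|S)] only depends on [#|S|] and on the number of elements
    of [S] in the part of [u]. If [S] is resolving, two vertices outside [S]
    therefore lie in different parts, so each part meeting the complement of [S]
    has all but one of its vertices in [S]; as the parts have equal sizes, two
    such parts cannot coexist, and at most one vertex lies outside [S]. *)

Set Implicit Arguments.
Unset Strict Implicit.
Unset Printing Implicit Defensive.

Lemma dist_leq (G : cgraph) (u v : G) (p : seq G) :
  path (@adj G) u p -> uniq (u :: p) -> last u p = v -> dist u v <= size p.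
Proof.
move=> pathp uniqp lastp; rewrite /dist; case: ex_minnP => m _; apply.
by apply/existsP; exists (in_tuple p); rewrite pathp uniqp lastp eqxx.
Qed.

(** Distinctness of the vertices is dropped: the lemma only serves to exclude distances 0 and 1, or
    to read off what they mean. *)
Lemma dist_path (G : cgraph) (u v : G) :
  exists2 p : seq G, size p = dist u v & path (@adj G) u p /\ last u p = v.
Proof.
rewrite /dist; case: ex_minnP => m /existsP[p /and3P[pathp _ /eqP lastp]] _.
by exists p; rewrite ?size_tuple.
Qed.

Lemma dist_eq0 (G : cgraph) (u v : G) : (dist u v == 0) = (u == v).
Proof.
apply/eqP/eqP => [d0|<-]; last first.
  by apply/eqP; rewrite -leqn0; apply: (@dist_leq _ _ _ [::]).
by have [p] := dist_path u v; rewrite d0 => /size0nil -> [].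
Qed.

Lemma dist_eq1 (G : cgraph) (u v : G) : (dist u v == 1) = adj u v.
Proof.
apply/eqP/idP => [d1|uv].
  have [p] := dist_path u v; rewrite d1.
  by case: p => [|x [|]] //= _ [/andP[ux _] <-].
have uDv : u != v by apply: contraTneq uv => ->; rewrite adj_irrefl.
apply/eqP; rewrite eqn_leq lt0n dist_eq0 uDv andbT.
by apply: (@dist_leq _ _ _ [:: v]); rewrite //= ?uv // inE andbT.
Qed.

Lemma dist_eq2 (G : cgraph) (u v w : G) :
  u != v -> ~~ adj u v -> adj u w -> adj w v -> dist u v = 2.
Proof.
move=> uDv nuv uw wv; apply/eqP; rewrite eqn_leq; apply/andP; split.
  apply: (@dist_leq _ _ _ [:: w; v]); rewrite //= ?uw ?wv //.
  rewrite !inE negb_or uDv !andbT.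
  apply/andP; split; last by apply: contraTneq wv => ->; rewrite adj_irrefl.
  by apply: contraTneq uw => ->; rewrite adj_irrefl.
by move: uDv nuv; rewrite -dist_eq0 -dist_eq1; case: (dist u v) => [|[|]].
Qed.

(** Multisets are compared value by value, so this reduces their equality to counting elements of
    [S] at a given distance. *)
Lemma mset_repr_mult (G : cgraph) (u : G) (S : {set G}) (a : nat) :
  mset_repr u S a = #|[set w in S | dist u w == a]|.
Proof.
rewrite /mset_repr mset_seqE count_map -size_filter cardE; congr size.
rewrite {1}/enum_mem -filter_predI.
by apply: eq_filter => w; rewrite !inE andbC.
Qed.

(** The upper bound is free: the complement of a single vertex [x] leaves no pair to separate, so it
    is resolving. The hypothesis on complements gives the lower bound. *)
Lemma dim_ms_card_pred (G : cgraph) : 0 < #|G| ->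
  (forall S : {set G}, outer_mset_resolving S -> #|~: S| <= 1) ->
  dim_ms G = #|G| - 1.
Proof.
move=> /card_gt0P[x _] res_card; rewrite /dim_ms; case: ex_minnP => m.
move=> /existsP[S /andP[Sres /eqP <-]] Smin; apply/eqP.
rewrite eqn_leq leq_subLR addnC -[X in _ && (X <= _)](cardsC S).
rewrite leq_add2l res_card // andbT.
rewrite subn1 -(cardsC1 x) Smin //; apply/existsP.
exists [set~ x]; rewrite eqxx andbT; apply/'forall_forallP => u v.
by rewrite !inE !negbK; apply/implyP => /and3P[/eqP-> /eqP->]; rewrite eqxx.
Qed.

Section MultipartiteColoring.

Variables (G : cgraph) (T : finType) (c : G -> T).
Hypothesis adj_c : forall u v : G, adj u v = (c u != c v).
Hypothesis other_part : forall i : T, exists w, c w != i.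

(** Describing the parts as fibres of a colouring of [G] itself avoids transporting distances along
    the isomorphism. *)
Definition part (i : T) : {set G} := [set w | c w == i].

Lemma multipartite_dist (u v : G) :
  u != v -> dist u v = if c u == c v then 2 else 1.
Proof.
move=> uDv; case: eqVneq => [cuv|cuv]; last by apply/eqP; rewrite dist_eq1 adj_c.
(* Any vertex outside the common part is adjacent to both [u] and [v], hence the midpoint of a path
   of length 2. *)
have [w cw] := other_part (c u).
apply: (@dist_eq2 _ _ _ w) => //; rewrite adj_c ?cuv ?eqxx //.
  by rewrite -cuv eq_sym.
by rewrite -cuv.
Qed.

Lemma multipartite_mset_repr (S : {set G}) (u v : G) :
  u \notin S -> v \notin S ->
  #|S :&: part (c u)| = #|S :&: part (c v)| -> mset_repr u S = mset_repr v S.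
Proof.
(* Since [x] is outside [S], the distance 0 never occurs; only the values 1 and 2 have to be
   counted. *)
have multE x a : x \notin S -> mset_repr x S a =
    if a == 2 then #|S :&: part (c x)|
    else if a == 1 then #|S :\: part (c x)| else 0.
  move=> xS; rewrite mset_repr_mult.
  have -> : [set w in S | dist x w == a] =
      [set w in S | (if c w == c x then 2 else 1) == a].
    apply/setP => w; rewrite !inE; case: (boolP (w \in S)) => //= wS.
    rewrite multipartite_dist 1?[c w == _]eq_sym //.
    by apply: contraNneq xS => ->.
  case: a => [|[|[|a]]] /=; try (apply/eqP; rewrite cards_eq0 -subset0;
    by apply/subsetP => w; rewrite !inE; case: ifP; rewrite andbF).
    by apply: eq_card => w; rewrite !inE andbC; case: (c w == c x).
  by apply: eq_card => w; rewrite !inE; case: (c w == c x).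
by move=> uS vS eq_uv; apply/msetP => a; rewrite !multE // !cardsD eq_uv.
Qed.

Lemma multipartite_resolving_compl_card (m : nat) (S : {set G}) :
  (forall i, #|part i| = m) -> outer_mset_resolving S -> #|~: S| <= 1.
Proof.
move=> part_card /'forall_forallP Sres.
have eq_out u v : u \notin S -> v \notin S ->
    #|S :&: part (c u)| = #|S :&: part (c v)| -> u = v.
  move=> uS vS eq_uv; apply: contraTeq isT => uDv; have /implyP := Sres u v.
  by rewrite uS vS uDv (multipartite_mset_repr uS vS eq_uv) eqxx; apply.
(* A second vertex of the part of [u] outside [S] would equal [u] by [eq_out], so [S] misses only
   [u] there. *)
have in_part u : u \notin S -> #|S :&: part (c u)| = m.-1.
  move=> uS; rewrite -(part_card (c u)) (cardsD1 u (part _)) inE eqxx /=.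
  apply: eq_card => w; rewrite !inE; case: (eqVneq (c w)) => [cw|]; last first.
    by rewrite !andbF.
  rewrite !andbT; have [->|wDu] := eqVneq w u; first exact: negbTE.
  by apply: contraNT wDu => wS; apply/eqP/eq_out; rewrite ?cw.
(* Both counts are now [m.-1], so [eq_out] applies even across different parts. *)
apply/card_le1_eqP => u v; rewrite !inE => uS vS.
by apply: eq_out; rewrite ?in_part.
Qed.

End MultipartiteColoring.

Lemma card_tag_fiber (k : nat) (r : 'I_k -> nat) (i : 'I_k) :
  #|[set x : {i : 'I_k & 'I_(r i)} | tag x == i]| = r i.
Proof.
have Tagged_inj : injective (Tagged (fun j => 'I_(r j)) (i := i)).
  by move=> x y /eqP; rewrite eq_Tagged => /eqP.
rewrite -[RHS]card_ord -cardsT -(card_imset _ Tagged_inj).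
apply: eq_card => -[j x]; rewrite inE; apply/eqP/imsetP => [/= ji|[y _ ->] //].
by case: _ / ji; exists x.
Qed.

Theorem mainTheorem6 (k n : nat) (r : 'I_k -> nat) (G : cgraph)
  (hk : 2 <= k)
  (hG : graph_iso G (complete_multipartite r))
  (hreq : forall i j : 'I_k, r i = r j)
  (hr2 : forall i : 'I_k, 2 <= r i)
  (hn : \sum_(i < k) r i = n) :
  dim_ms G = n - 1.
Proof.
case: hG => f [f_bij f_adj].
(* The indices 0 and 1 exist because [k] is at least 2; every part differs from one of these two,
   which provides [other_part]. *)
pose c u := tag (f u); pose i0 := Ordinal (ltnW hk); pose i1 := Ordinal hk.
have part_card i : #|part c i| = r i.
  rewrite -card_tag_fiber -[LHS](card_imset _ (bij_inj f_bij)).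
  apply: eq_card => x; rewrite inE; apply/imsetP/idP => [[u]|].
    by rewrite inE => cu ->.
  by case: f_bij => g _ gK cx; exists (g x); rewrite ?inE /c gK.
have part_ex i : exists w, c w = i.
  have /card_gt0P[w] : 0 < #|part c i| by rewrite part_card ltnW.
  by rewrite inE => /eqP; exists w.
have card_G : #|G| = n.
  rewrite -hn -sum1_card (partition_big c predT) //=; apply: eq_bigr => i _.
  by rewrite -part_card -sum1_card; apply: eq_bigl => w; rewrite inE.
rewrite -card_G; apply: dim_ms_card_pred => [|S].
  by have [w _] := part_ex i0; apply/card_gt0P; exists w.
apply: (@multipartite_resolving_compl_card _ _ c _ _ (r i0)) => [u v|i|i].
- by rewrite -f_adj.
- have [->|iN0] := eqVneq i i0.
    by have [w cw] := part_ex i1; exists w; rewrite cw.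
  by have [w cw] := part_ex i0; exists w; rewrite cw eq_sym.
- by rewrite part_card.
Qed.
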